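(* Let $\Lambda,\Omega\subset\mathbb{R}$ be open and let $$\mathcal{P}(2)=g_{0,1}(x,\cdot)\,\mathrm{D}_{0,1}+g_{1,1}(x,\cdot)\,\mathrm{D}_{1,1}+g_{2,1}(x,\cdot)\,\mathrm{D}_{2,1},\qquad g_{k,h}\in\mathcal{C}(\Lambda\times\Omega,\mathbb{R}).$$ A necessary and sufficient condition for $\mathcal{P}(2)$ to be decomposed into the form $$\mathcal{P}(2)=\big[b_{1,0,1}(x,\cdot)\,\mathrm{D}_{0,1}+b_{1,1,1}(x,\cdot)\,\mathrm{D}_{1,1}\big]\big[b_{2,0,1}(x,\cdot)\,\mathrm{D}_{0,1}+b_{2,1,1}(x,\cdot)\,\mathrm{D}_{1,1}\big],$$ with $b_{1,k,h}\in\mathcal{C}(\Lambda\times\Omega,\mathbb{R})$ and $b_{2,k,h}\in\mathcal{C}^1(\Lambda\times\Omega,\mathbb{R})$, is that these functions satisfy, at every $(x,u)\in\Lambda\times\Omega$, \begin{align*} g_{2,1}&=b_{1,1,1}b_{2,1,1},\\ g_{1,1}&=b_{1,0,1}b_{2,1,1}+b_{1,1,1}b_{2,0,1}+b_{1,1,1}\mathrm{D}_{1,1}(b_{2,1,1})+b_{1,1,1}\mathrm{D}_{1,2}(b_{2,0,1})\,u,\\ 0&=b_{1,1,1}\mathrm{D}_{1,2}(b_{2,1,1}),\\ g_{0,1}&=b_{1,0,1}b_{2,0,1}+b_{1,1,1}\mathrm{D}_{1,1}(b_{2,0,1}). \end{align*}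
   Context: For a function $u=u(x)$: $\mathrm{D}_{0,1}u=u$, $\mathrm{D}_{1,1}u=u_x$, $\mathrm{D}_{2,1}u=u_{2x}=\frac{d^2u}{dx^2}$. For a function $b(x,u)$ on $\Lambda\times\Omega$, regarded as a function of two independent variables, $\mathrm{D}_{1,1}(b)=\partial b/\partial x$ and $\mathrm{D}_{1,2}(b)=\partial b/\partial u$ are the partial derivatives with respect to the first and second variable. The operator $\mathcal{P}(2)$ acts on $u$ by $\mathcal{P}(2)u=g_{0,1}(x,u)u+g_{1,1}(x,u)u_x+g_{2,1}(x,u)u_{2x}$. The product of the two brackets acts on $u$ by first forming $w(x)=b_{2,0,1}(x,u(x))u(x)+b_{2,1,1}(x,u(x))u_x(x)$ and then $b_{1,0,1}(x,u(x))\,w(x)+b_{1,1,1}(x,u(x))\,\frac{dw}{dx}(x)$; that is, the coefficients of both factors are evaluated at the original function $u$. Equality of operators means that both sides give the same result on every $u\in\mathcal{C}^2(\Lambda_0,\Omega)$, for open $\Lambda_0\subset\Lambda$. *)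

(* Defs.v *)
(* Stdlib reals with Coquelicot. *)
From Stdlib Require Import Reals.
From Coquelicot Require Import Coquelicot.
Open Scope R_scope.

(* Functions on a set A are total functions of which only the values on A
   matter; all sets below are open, so two-sided derivatives at points of A
   depend only on those values. *)

Definition rect (A B : R -> Prop) : R * R -> Prop :=
  fun p => A (fst p) /\ B (snd p).

Definition D_1_1 (b : R * R -> R) (p : R * R) : R :=
  Derive (fun x => b (x, snd p)) (fst p).

Definition D_1_2 (b : R * R -> R) (p : R * R) : R :=
  Derive (fun u => b (fst p, u)) (snd p).

Definition C0_2d (S : R * R -> Prop) (b : R * R -> R) : Prop :=
  continuous_on S b.

Definition C1_2d (S : R * R -> Prop) (b : R * R -> R) : Prop :=
  (forall x u, S (x, u) ->
     ex_derive (fun t => b (t, u)) x /\ ex_derive (fun t => b (x, t)) u) /\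
  continuous_on S (D_1_1 b) /\ continuous_on S (D_1_2 b).

(* [ex_derive_n u 2] alone does not imply [ex_derive_n u 1], since [Derive] is
   total; hence the conditions at every order up to k. *)
Definition Ck (k : nat) (A B : R -> Prop) (u : R -> R) : Prop :=
  (forall x, A x -> B (u x)) /\
  forall j, (j <= k)%nat ->
    (forall x, A x -> ex_derive_n u j x) /\ continuous_on A (Derive_n u j).

Definition P2 (g01 g11 g21 : R * R -> R) (u : R -> R) : R -> R :=
  fun x => g01 (x, u x) * Derive_n u 0 x
         + g11 (x, u x) * Derive_n u 1 x
         + g21 (x, u x) * Derive_n u 2 x.

(* The coefficients are evaluated along [u], the derivatives act on [w]. *)
Definition bracket (b0 b1 : R * R -> R) (u w : R -> R) : R -> R :=
  fun x => b0 (x, u x) * Derive_n w 0 x + b1 (x, u x) * Derive_n w 1 x.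

Definition bracket_prod (b101 b111 b201 b211 : R * R -> R) (u : R -> R)
  : R -> R :=
  bracket b101 b111 u (bracket b201 b211 u u).

Definition op_eq (Lambda Omega : R -> Prop) (P Q : (R -> R) -> R -> R) : Prop :=
  forall Lambda0 : R -> Prop,
    open Lambda0 -> (forall x, Lambda0 x -> Lambda x) ->
    forall u, Ck 2 Lambda0 Omega u -> forall x, Lambda0 x -> P u x = Q u x.

(* Main.v *)
Require Import Defs.
From Stdlib Require Import Reals Lra Lia.
From Coquelicot Require Import Coquelicot.
Open Scope R_scope.

(** Let [u] be twice differentiable.  Differentiating
    [w(t) = b201(t, u(t)) u(t) + b211(t, u(t)) u'(t)] by the chain rule turns the
    product of the two brackets at [x] into
    [u * A + u' * B + u'^2 * C + u'' * D], where [A], [B], [C], [D] depend only on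
    the point [(x, u(x))] ([bracket_prod_expand]).  The four conditions say that
    [g01 = A], [g11 = B], [0 = C], [g21 = D], so they give the operator equality
    at once.

    Conversely, fix a point [(x, y)].  A quadratic polynomial, restricted to a
    small open set, is an admissible [u] with [u(x) = y] and any prescribed
    [u'(x) = p] and [u''(x) = q] ([Ck_quadratic_jet]).  The operator equality thus
    becomes an identity between polynomials in [p] and [q], whose coefficients
    can be compared.  The constant coefficient only gives [y * g01 = y * A]; this
    determines [g01] when [y <> 0], and the case [y = 0] follows because both
    sides are continuous in [y] ([eq_at_zero_of_continuous]). *)

Lemma open_rect (A B : R -> Prop) : open A -> open B -> open (rect A B).
Proof.
intros oA oB [x y] [Ax By].
destruct (oA x Ax) as [d Hd]; destruct (oB y By) as [e He].
assert (Hm : 0 < Rmin d e) by (apply Rmin_pos; apply cond_pos).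
exists (mkposreal _ Hm); intros [x' y'] [H1 H2]; split.
- apply Hd; apply ball_le with (2 := H1); apply Rmin_l.
- apply He; apply ball_le with (2 := H2); apply Rmin_r.
Qed.

Lemma continuous_of_C0_2d (S : R * R -> Prop) (f : R * R -> R) (p : R * R) :
  open S -> C0_2d S f -> S p -> continuous f p.
Proof.
intros oS Cf Sp; exact (continuous_continuous_on S f p (oS p Sp) Cf).
Qed.

(** The chain rule needs joint differentiability of [b], which holds because one
    partial derivative exists near the point and is continuous there while the
    other exists at the point. *)
Lemma is_derive_along (S : R * R -> Prop) (b : R * R -> R) (u : R -> R)
    (x du : R) :
  open S -> C1_2d S b -> S (x, u x) -> is_derive u x du ->
  is_derive (fun t => b (t, u t)) x
    (D_1_1 b (x, u x) + D_1_2 b (x, u x) * du).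
Proof.
intros oS [Hex [C1 C2]] Sx Du.
apply is_derive_Reals.
replace (D_1_1 b (x, u x) + D_1_2 b (x, u x) * du)
  with (D_1_1 b (x, u x) * 1 + D_1_2 b (x, u x) * du) by ring.
apply (derivable_pt_lim_comp_2d (fun s t => b (s, t)) (fun t => t) u).
- apply filterdiff_differentiable_pt_lim.
  apply (is_derive_filterdiff (fun s t => b (s, t)) x (u x)
           (fun s t => D_1_1 b (s, t)) (D_1_2 b (x, u x))).
  + apply filter_imp with (2 := oS _ Sx); intros [s t] Hst.
    apply Derive_correct, (Hex _ _ Hst).
  + apply Derive_correct, (Hex _ _ Sx).
  + apply continuous_ext with (f := D_1_1 b).
    * now intros [s t].
    * now apply continuous_of_C0_2d with S.
- apply derivable_pt_lim_id.
- now apply is_derive_Reals.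
Qed.

(** The quadratic term in [u'] comes from differentiating [b211(t, u(t))] in its
    second variable while it multiplies [u'(t)]; since [P2] has no such term, it is
    the source of the condition [0 = b111 * D_1_2 b211]. *)
Lemma bracket_prod_expand (Lambda0 Omega : R -> Prop) (S : R * R -> Prop)
    (b101 b111 b201 b211 : R * R -> R) (u : R -> R) (x : R) :
  open S -> C1_2d S b201 -> C1_2d S b211 ->
  Ck 2 Lambda0 Omega u -> Lambda0 x -> S (x, u x) ->
  bracket_prod b101 b111 b201 b211 u x =
    u x * (b101 (x, u x) * b201 (x, u x) + b111 (x, u x) * D_1_1 b201 (x, u x))
    + Derive_n u 1 x *
      (b101 (x, u x) * b211 (x, u x) + b111 (x, u x) * b201 (x, u x)
       + b111 (x, u x) * D_1_1 b211 (x, u x)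
       + b111 (x, u x) * D_1_2 b201 (x, u x) * u x)
    + Derive_n u 1 x * Derive_n u 1 x * (b111 (x, u x) * D_1_2 b211 (x, u x))
    + Derive_n u 2 x * (b111 (x, u x) * b211 (x, u x)).
Proof.
intros oS H1 H2 [_ Hu] Lx Sx.
assert (Du : is_derive u x (Derive_n u 1 x)).
{ apply Derive_correct.
  exact (proj1 (Hu 1%nat ltac:(lia)) x Lx). }
assert (DDu : is_derive (Derive_n u 1) x (Derive_n u 2 x)).
{ apply Derive_correct.
  exact (proj1 (Hu 2%nat ltac:(lia)) x Lx). }
assert (D1 := is_derive_along _ _ _ _ _ oS H1 Sx Du).
assert (D2 := is_derive_along _ _ _ _ _ oS H2 Sx Du).
assert (Dw := is_derive_plus _ _ _ _ _
  (is_derive_mult _ _ _ _ _ D1 Du Rmult_comm)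
  (is_derive_mult _ _ _ _ _ D2 DDu Rmult_comm)).
apply is_derive_unique in Dw.
unfold bracket_prod, bracket at 1.
change (Derive_n (bracket b201 b211 u u) 1 x) with
  (Derive (fun t => b201 (t, u t) * u t + b211 (t, u t) * Derive_n u 1 t) x).
unfold plus, mult in Dw; simpl in Dw.
change (Derive_n u 1) with (Derive (fun t => u t)) in *.
unfold bracket; simpl in Dw |- *.
rewrite Dw; ring.
Qed.

Definition quadratic (x y p q : R) : R -> R :=
  fun t => y + p * (t - x) + q / 2 * (t - x) ^ 2.

Lemma is_derive_quadratic (x y p q t : R) :
  is_derive (quadratic x y p q) t (p + q * (t - x)).
Proof.
unfold quadratic; auto_derive; [easy | field].
Qed.

Lemma Derive_n_quadratic_1 (x y p q t : R) :
  Derive_n (quadratic x y p q) 1 t = p + q * (t - x).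
Proof. apply is_derive_unique, is_derive_quadratic. Qed.

Lemma is_derive_Derive_n_quadratic_1 (x y p q t : R) :
  is_derive (Derive_n (quadratic x y p q) 1) t q.
Proof.
apply is_derive_ext with (f := fun s => p + q * (s - x)).
- intros s; symmetry; apply Derive_n_quadratic_1.
- auto_derive; [easy | ring].
Qed.

Lemma Derive_n_quadratic_2 (x y p q t : R) :
  Derive_n (quadratic x y p q) 2 t = q.
Proof. apply is_derive_unique, is_derive_Derive_n_quadratic_1. Qed.

Lemma continuous_quadratic (x y p q t : R) :
  continuous (quadratic x y p q) t.
Proof.
apply (ex_derive_continuous (quadratic x y p q)).
eexists; apply is_derive_quadratic.
Qed.

(** Every 2-jet with base value in [Omega] is realised by an admissible function:
    cutting the domain down to the preimage of [Omega] keeps it open and forces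
    the values of the polynomial into [Omega]. *)
Lemma Ck_quadratic_jet (Lambda Omega : R -> Prop) (x y p q : R) :
  open Lambda -> open Omega -> Lambda x -> Omega y ->
  exists (Lambda0 : R -> Prop) (u : R -> R),
    open Lambda0 /\ (forall t, Lambda0 t -> Lambda t) /\ Lambda0 x /\
    Ck 2 Lambda0 Omega u /\
    u x = y /\ Derive_n u 1 x = p /\ Derive_n u 2 x = q.
Proof.
intros oL oO Lx Oy.
set (u := quadratic x y p q).
assert (ux : u x = y) by (unfold u, quadratic; ring).
exists (fun t => Lambda t /\ Omega (u t)), u.
split; [|split; [now intros t [] | split; [now rewrite ux | split]]].
- apply open_and; [exact oL |].
  apply open_comp; [| exact oO].
  intros t _; apply continuous_quadratic.
- split; [now intros t [] |].
  intros j Hj; destruct j as [|[|[|j]]]; [| | | lia].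
  + split; [easy |].
    apply continuous_on_forall; intros t _; apply continuous_quadratic.
  + split.
    * intros t _; eexists; apply is_derive_quadratic.
    * apply continuous_on_forall; intros t _.
      apply (ex_derive_continuous (Derive_n u 1)).
      eexists; apply is_derive_Derive_n_quadratic_1.
  + split.
    * intros t _; eexists; apply is_derive_Derive_n_quadratic_1.
    * apply continuous_on_forall; intros t _.
      apply continuous_ext with (f := fun _ => q).
      { intros s; symmetry; apply Derive_n_quadratic_2. }
      apply continuous_const.
- unfold u; rewrite Derive_n_quadratic_1, Derive_n_quadratic_2.
  repeat split; [exact ux | ring].
Qed.

(** The punctured neighbourhoods of a real point are never empty, so a limit along
    them determines the value of a continuous function at the point. *)
Lemma eq_at_zero_of_continuous (B : R -> Prop) (f g : R -> R) :
  open B -> B 0 -> continuous f 0 -> continuous g 0 ->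
  (forall y, B y -> y * f y = y * g y) -> f 0 = g 0.
Proof.
intros oB B0 Cf Cg H.
assert (Lf : filterlim f (locally' 0) (locally (f 0))).
{ apply filterlim_filter_le_1 with (2 := Cf); apply filter_le_within. }
assert (Lg : filterlim g (locally' 0) (locally (g 0))).
{ apply filterlim_filter_le_1 with (2 := Cg); apply filter_le_within. }
apply (filterlim_locally_unique (F := Rbar_locally' 0) f); [exact Lf |].
apply filterlim_ext_loc with (2 := Lg).
unfold locally', within.
apply filter_imp with (2 := oB 0 B0); intros y By y0.
symmetry; apply Rmult_eq_reg_l with y; [now apply H | exact y0].
Qed.

Lemma continuous_section (f : R * R -> R) (x y : R) :
  continuous f (x, y) -> continuous (fun t => f (x, t)) y.
Proof.
intros Cf.
apply (continuous_comp_2 (fun _ => x) (fun t => t) (fun s t => f (s, t)));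
  [apply continuous_const | apply continuous_id |].
apply continuous_ext with (2 := Cf); now intros [].
Qed.

Theorem proposition3p1
  (Lambda Omega : R -> Prop) (hLambda : open Lambda) (hOmega : open Omega)
  (g01 g11 g21 : R * R -> R)
  (hg01 : C0_2d (rect Lambda Omega) g01)
  (hg11 : C0_2d (rect Lambda Omega) g11)
  (hg21 : C0_2d (rect Lambda Omega) g21)
  (b101 b111 b201 b211 : R * R -> R)
  (hb101 : C0_2d (rect Lambda Omega) b101)
  (hb111 : C0_2d (rect Lambda Omega) b111)
  (hb201 : C1_2d (rect Lambda Omega) b201)
  (hb211 : C1_2d (rect Lambda Omega) b211) :
  op_eq Lambda Omega (P2 g01 g11 g21) (bracket_prod b101 b111 b201 b211) <->
  (forall x u : R, Lambda x -> Omega u ->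
     g21 (x, u) = b111 (x, u) * b211 (x, u) /\
     g11 (x, u) = b101 (x, u) * b211 (x, u) + b111 (x, u) * b201 (x, u)
                  + b111 (x, u) * D_1_1 b211 (x, u)
                  + b111 (x, u) * D_1_2 b201 (x, u) * u /\
     0 = b111 (x, u) * D_1_2 b211 (x, u) /\
     g01 (x, u) = b101 (x, u) * b201 (x, u) + b111 (x, u) * D_1_1 b201 (x, u)).
Proof.
assert (oS := open_rect _ _ hLambda hOmega).
split.
- intros Heq.
  assert (Hpoly : forall x y p q, Lambda x -> Omega y ->
    g01 (x, y) * y + g11 (x, y) * p + g21 (x, y) * q =
    y * (b101 (x, y) * b201 (x, y) + b111 (x, y) * D_1_1 b201 (x, y))
    + p * (b101 (x, y) * b211 (x, y) + b111 (x, y) * b201 (x, y)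
           + b111 (x, y) * D_1_1 b211 (x, y)
           + b111 (x, y) * D_1_2 b201 (x, y) * y)
    + p * p * (b111 (x, y) * D_1_2 b211 (x, y))
    + q * (b111 (x, y) * b211 (x, y))).
  { intros x y p q Lx Oy.
    destruct (Ck_quadratic_jet Lambda Omega x y p q hLambda hOmega Lx Oy)
      as (L0 & u & oL0 & L0L & L0x & Cu & ux & u1 & u2).
    assert (E := Heq L0 oL0 L0L u Cu x L0x).
    rewrite (bracket_prod_expand L0 Omega _ _ _ _ _ u x oS hb201 hb211 Cu L0x)
      in E by (rewrite ux; now split).
    unfold P2 in E; rewrite u1, u2 in E.
    change (Derive_n u 0 x) with (u x) in E.
    rewrite ux in E; exact E. }
  assert (Hzero : forall x y, Lambda x -> Omega y ->
    y * g01 (x, y) =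
    y * (b101 (x, y) * b201 (x, y) + b111 (x, y) * D_1_1 b201 (x, y))).
  { intros x y Lx Oy; assert (E := Hpoly x y 0 0 Lx Oy); lra. }
  intros x y Lx Oy.
  assert (E0 := Hzero x y Lx Oy).
  (* These three jets separate the coefficients of q, p and p^2. *)
  assert (Eq := Hpoly x y 0 1 Lx Oy).
  assert (Ep := Hpoly x y 1 0 Lx Oy).
  assert (Em := Hpoly x y (-1) 0 Lx Oy).
  split; [lra | split; [lra | split; [lra |]]].
  destruct (Req_dec y 0) as [-> | y0];
    [| now apply Rmult_eq_reg_l with y].
  assert (Sx : rect Lambda Omega (x, 0)) by now split.
  apply (eq_at_zero_of_continuous Omega (fun t => g01 (x, t))
    (fun t => b101 (x, t) * b201 (x, t) + b111 (x, t) * D_1_1 b201 (x, t)));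
    [exact hOmega | exact Oy | | | intros t Ot; now apply Hzero].
  + apply continuous_section; now apply continuous_of_C0_2d with (1 := oS).
  + destruct hb201 as [Hex [Cd _]].
    apply (continuous_plus (fun t => b101 (x, t) * b201 (x, t))
             (fun t => b111 (x, t) * D_1_1 b201 (x, t))).
    * apply (continuous_mult (fun t => b101 (x, t)) (fun t => b201 (x, t))).
      -- apply continuous_section; now apply continuous_of_C0_2d with (1 := oS).
      -- apply (ex_derive_continuous (fun t => b201 (x, t))).
         apply (Hex x 0 Sx).
    * apply (continuous_mult (fun t => b111 (x, t))
               (fun t => D_1_1 b201 (x, t))).
      -- apply continuous_section; now apply continuous_of_C0_2d with (1 := oS).
      -- apply continuous_section; now apply continuous_of_C0_2d with (1 := oS).
- intros Hc L0 oL0 L0L u Cu x L0x.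
  assert (Lx := L0L x L0x); assert (Ox := proj1 Cu x L0x).
  rewrite (bracket_prod_expand L0 Omega _ _ _ _ _ u x oS hb201 hb211 Cu L0x)
    by now split.
  destruct (Hc x (u x) Lx Ox) as (E2 & E1 & Ez & E0).
  unfold P2; change (Derive_n u 0 x) with (u x).
  rewrite E0, E1, E2, <- Ez; ring.
Qed.
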